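(* For every $0<\delta<1$ and integers $s\geq 2$, $q\geq 0$, there is a constant $c=c(s,q,\delta)>0$ such that for all sufficiently large $n$ there is a collection $\mathcal{G}$ of multigraphs with vertex set $[n]$ and multiplicity at most $q$ such that: (i) for every $J\in F(n,s,q)$ there is $G\in\mathcal{G}$ such that $J$ is a submultigraph of $G$; (ii) for every $G\in\mathcal{G}$, $|\mathcal{H}(G,s,q)|\leq\delta\binom{n}{s}$; (iii) $\log|\mathcal{G}|\leq c\,n^{2-\frac{1}{4s}}\log n$.
   Context: A multigraph is a pair $(V,w)$ with $w:\binom{V}{2}\to\mathbb{N}$. Its multiplicity is $\mu(G)=\max_{xy}w(xy)$, and $S(G)=\sum_{xy\in\binom V2}w(xy)$. For $X\subseteq V$, $G[X]=(X,w|_{\binom X2})$. $(V,w)$ is a submultigraph of $(V',w')$ if $V=V'$ and $w(xy)\le w'(xy)$ for all pairs. Two multigraphs are isomorphic if there is a bijection of vertex sets preserving $w$. A multigraph is an $(s,q)$-graph if every $s$-element vertex set $X$ has $S(G[X])\le q$; $F(n,s,q)$ is the set of $(s,q)$-graphs on $[n]$. $\mathcal{H}(s,q)=\{G=([s],w):\mu(G)\le q,\ S(G)>q\}$ and, for a multigraph $G=(V,w)$, $\mathcal{H}(G,s,q)$ is the set of $X\in\binom{V}{s}$ such that $G[X]$ is isomorphic to some member of $\mathcal{H}(s,q)$. Logarithms are natural. *)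

(* Defs.v *)
From mathcomp Require Import all_boot.
From mathcomp Require Import boolp.

Set Implicit Arguments.
Unset Strict Implicit.
Unset Printing Implicit Defensive.

Definition upair (V : finType) := {e : {set V} | #|e| == 2}.

Lemma upair_map_subproof (V W : finType) (f : V -> W) (fI : injective f)
  (e : upair V) : #|f @: val e| == 2.
Proof. by rewrite card_imset // (valP e). Qed.

Definition upair_map (V W : finType) (f : V -> W) (fI : injective f)
  (e : upair V) : upair W := Sub (f @: val e) (upair_map_subproof fI e).

(* A weight function w on 2-subsets of V; nat contains 0, so w may vanish. *)
Definition multigraph (V : finType) := {ffun upair V -> nat}.

Definition multiplicity (V : finType) (G : multigraph V) : nat :=
  \max_(e : upair V) G e.

Definition weight (V : finType) (G : multigraph V) : nat :=
  \sum_(e : upair V) G e.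

Definition induced (V : finType) (G : multigraph V) (X : {set V}) :
    multigraph {x : V | x \in X} :=
  [ffun e => G (upair_map val_inj e)].

Definition submultigraph (V : finType) (G H : multigraph V) : bool :=
  [forall e : upair V, G e <= H e].

Definition isomorphic (V W : finType) (G : multigraph V) (H : multigraph W) :
    Prop :=
  exists (f : V -> W) (f_bij : bijective f),
    forall e : upair V, H (upair_map (bij_inj f_bij) e) = G e.

Definition sq_graph (V : finType) (s q : nat) (G : multigraph V) : bool :=
  [forall X : {set V}, (#|X| == s) ==> (weight (induced G X) <= q)].

Definition F (n s q : nat) : pred (multigraph 'I_n) := sq_graph s q.
Arguments F : clear implicits.

Definition bad_graphs (s q : nat) : pred (multigraph 'I_s) :=
  [pred H | (multiplicity H <= q) && (q < weight H)].
Arguments bad_graphs : clear implicits.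

Definition bad_copies (V : finType) (G : multigraph V) (s q : nat) :
    {set {set V}} :=
  [set X : {set V} | (#|X| == s) &&
    `[< exists2 H : multigraph 'I_s,
          H \in bad_graphs s q & isomorphic (induced G X) H >]].

(* Main.v *)
Require Import Defs.
From mathcomp Require Import all_boot all_order all_algebra finmap.
From mathcomp Require Import reals exp.
From mathcomp Require Import boolp zify.

Set Implicit Arguments.
Unset Strict Implicit.
Unset Printing Implicit Defensive.

(* Suppose that G has many bad s-sets, and that J <= G is an (s,q)-graph.  The
   relation I of pairs on which J and G agree contains no bad s-set of G as a
   clique.  One finds a set C of pairs containing I, missing a positive
   proportion of all pairs, and determined by few bits; subtracting 1 from G
   outside C keeps it above J and lowers its weight by a multiple of n^2, so
   that boundedly many repetitions suffice.

   The set C is found by induction on the length of the tuples.  Reveal the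
   I-neighbourhoods of a set A of vertices that meets every set of more than
   tau vertices of the form {a | a :: t is a dangerous tuple, a I-adjacent to
   all of t}.  The tuples t with such an a in A are dangerous for I and known:
   if they have positive density, recurse on them.  Otherwise discard them; the
   other t have few such a, hence for a typical vertex a the neighbourhood of a
   contains very few tuples of the dense link of a.  In a dense hypergraph such
   a set is contained, up to h exceptional vertices, in one of polynomially
   many sets missing a positive proportion of the vertices. *)

(** * Coverings by short lists *)

(** [M] bounds the number of containers. If no [x] satisfies [P], the empty list is a covering;
    impossible cases are closed this way. *)
Definition covered (X : Type) (Y : eqType) (M : nat) (P : X -> Prop)
    (R : X -> Y -> Prop) : Prop :=
  exists2 L : seq Y, size L <= M &
    forall x, P x -> exists2 y, y \in L & R x y.

Lemma covered_map (X X' : Type) (Y Y' : eqType) (M M' : nat)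
    (f : X' -> X) (g : Y -> Y') (P : X -> Prop) (P' : X' -> Prop)
    (R : X -> Y -> Prop) (R' : X' -> Y' -> Prop) :
  M <= M' -> (forall x, P' x -> P (f x)) ->
  (forall x y, P' x -> R (f x) y -> R' x (g y)) ->
  covered M P R -> covered M' P' R'.
Proof.
move=> leM PP RR [L sL cL]; exists (map g L); first by rewrite size_map (leq_trans sL).
move=> x P'x; have [y yL Rxy] := cL _ (PP _ P'x).
by exists (g y); [exact: map_f | exact: RR].
Qed.

Lemma covered_sub (X : Type) (Y : eqType) (M M' : nat)
    (P P' : X -> Prop) (R R' : X -> Y -> Prop) :
  M <= M' -> (forall x, P' x -> P x) ->
  (forall x y, P' x -> R x y -> R' x y) ->
  covered M P R -> covered M' P' R'.
Proof. exact: (@covered_map X X Y Y M M' id id). Qed.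

(** Guessing a certificate [c] in [T] costs a factor [#|T|]. *)
Lemma covered_union (X : Type) (Y : eqType) (T : finType) (M : nat)
    (Q : T -> X -> Prop) (P : X -> Prop) (R : X -> Y -> Prop) :
  (forall c, covered M (Q c) R) -> (forall x, P x -> exists c, Q c x) ->
  covered (#|T| * M) P R.
Proof.
move=> cQ PQ.
have /choice[L HL] : forall c, exists L : seq Y, size L <= M /\
    forall x, Q c x -> exists2 y, y \in L & R x y.
  by move=> c; have [L ? ?] := cQ c; exists L.
exists (flatten [seq L c | c <- enum T]).
  rewrite size_flatten sumnE /shape -map_comp big_map.
  rewrite -sum_nat_const big_enum /=.
  by apply: leq_sum => c _; case: (HL c).
move=> x /PQ[c Qcx]; have [_ /(_ _ Qcx)[y yL Rxy]] := HL c.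
exists y => //; apply/flattenP; exists (L c) => //.
by rewrite map_f // mem_enum.
Qed.

Lemma covered_or (X : Type) (Y : eqType) (M1 M2 : nat)
    (P P1 P2 : X -> Prop) (R : X -> Y -> Prop) :
  covered M1 P1 R -> covered M2 P2 R -> (forall x, P x -> P1 x \/ P2 x) ->
  covered (M1 + M2) P R.
Proof.
move=> [L1 s1 c1] [L2 s2 c2] PP; exists (L1 ++ L2).
  by rewrite size_cat leq_add.
move=> x /PP[/c1[y yL Rxy]|/c2[y yL Rxy]]; exists y => //.
  by rewrite mem_cat yL.
by rewrite mem_cat yL orbT.
Qed.

Lemma covered1 (X : Type) (Y : eqType) (M : nat) (y : Y) (P : X -> Prop)
    (R : X -> Y -> Prop) :
  0 < M -> (forall x, P x -> R x y) -> covered M P R.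
Proof. by move=> M0 PR; exists [:: y] => // x /PR; exists y; rewrite ?mem_head. Qed.

(** A list entry is chosen at each [a], encoded by its position below [M]; [y0] fills the positions
    beyond the end of [L a]. *)
Lemma covered_prod (X : Type) (Y : eqType) (V : finType) (M : nat)
    (P : V -> X -> Prop) (R : V -> X -> Y -> Prop) (y0 : Y) :
  (forall a, covered M (P a) (R a)) ->
  covered (M ^ #|V|) (fun x : V -> X => forall a, P a (x a))
    (fun x (y : {ffun V -> Y}) => forall a, R a (x a) (y a)).
Proof.
move=> cP.
have /choice[L HL] : forall a, exists L : seq Y, size L <= M /\
    forall x, P a x -> exists2 y, y \in L & R a x y.
  by move=> a; have [L ? ?] := cP a; exists L.
exists [seq [ffun a => nth y0 (L a) (c a)] | c : {ffun V -> 'I_M}].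
  by rewrite size_map -cardE card_ffun card_ord.
move=> x Px.
have /choice[c Hc] : forall a, exists i : 'I_M, R a (x a) (nth y0 (L a) i).
  move=> a; have [sL /(_ _ (Px a))[y yL Rxy]] := HL a.
  have iM : index y (L a) < M by rewrite (leq_trans _ sL) ?index_mem.
  by exists (Ordinal iM); rewrite /= nth_index.
exists [ffun a => nth y0 (L a) (c a)]; last by move=> a; rewrite ffunE.
apply/mapP; exists [ffun a => c a]; first by rewrite mem_enum.
by apply/ffunP => a; rewrite !ffunE.
Qed.

(** * Elementary counting and hitting sets *)

Lemma leq_expl m n e : m <= n -> m ^ e <= n ^ e.
Proof. by case: e => // e; rewrite leq_exp2r. Qed.

Lemma card_bigcup_leq (I T : finType) (P : pred I) (S : I -> {set T}) :
  #|\bigcup_(i | P i) S i| <= \sum_(i | P i) #|S i|.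
Proof.
elim/big_rec2: _ => [|i m A _ le]; first by rewrite cards0.
by rewrite (leq_trans (leq_card_setU _ _)) ?leq_add2l.
Qed.

(** Union bound: a set with at least [tau] elements is missed by at most [(#|V| - tau) ^ m] of the
    [#|V| ^ m] functions. *)
Lemma hitting_set (V W : finType) (S : W -> {set V}) (tau m : nat) :
  #|W| * (#|V| - tau) ^ m < #|V| ^ m ->
  exists A : {ffun 'I_m -> V}, forall w, tau <= #|S w| ->
    exists i, A i \in S w.
Proof.
move=> lt; apply: contrapT => noA.
suff : #|{ffun 'I_m -> V}| <= #|W| * (#|V| - tau) ^ m.
  by rewrite card_ffun card_ord leqNgt lt.
have sub : [set: {ffun 'I_m -> V}] \subset
    \bigcup_(w | tau <= #|S w|) [set A in ffun_on (mem (~: S w))].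
  apply/fintype.subsetP => A _; apply: contrapT => /negP nA; apply: noA.
  exists A => w tw; apply: contrapT => nAw; move/negP: nA; apply.
  apply/bigcupP; exists w => //; rewrite inE; apply/ffun_onP => i.
  by rewrite inE; apply/negP => Ai; apply: nAw; exists i.
move: (subset_leq_card sub); rewrite cardsT => /leq_trans; apply.
apply: leq_trans (card_bigcup_leq _ _) _.
rewrite -sum_nat_const big_mkcond /=; apply: leq_sum => w _.
case: ifP => // tw; rewrite cardsE card_ffun_on card_ord leq_expl //.
by rewrite cardsCs setCK leq_sub2l.
Qed.

(** * Vertex sets spanning few tuples of a dense hypergraph *)

Section Dense.
Variable V : finType.

Definition link (k : nat) (Phi : {set k.+1.-tuple V}) (a : V) :
    {set k.-tuple V} :=
  [set t : k.-tuple V | cons_tuple a t \in Phi].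

Lemma card_link k (Phi : {set k.+1.-tuple V}) :
  #|Phi| = \sum_a #|link Phi a|.
Proof.
rewrite -sum1_card (partition_big (fun t => thead t) xpredT) //=.
apply: eq_bigr => a _; rewrite -sum1_card.
rewrite (reindex_onto (fun t : k.-tuple V => cons_tuple a t)
  (fun t : k.+1.-tuple V => [tuple of behead t])).
  apply: eq_bigl => t; rewrite inE /= theadE eqxx andbT.
  rewrite (_ : (_ == t) = true) ?andbT //; apply/eqP; exact: val_inj.
by move=> t /andP[_ /eqP <-]; rewrite [RHS]tuple_eta; apply: val_inj.
Qed.

(** Averaging: values below [K / 2D] contribute at most half of the guaranteed [#|V| * K / D], and
    no value exceeds [K]. *)
Lemma card_large_values (f : V -> nat) (K : nat) :
  (forall a, f a <= K) -> 0 < K ->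
  forall D, #|V| * K <= D * (\sum_a f a) ->
  #|V| <= 2 * D * #|[set a | K <= 2 * D * f a]|.
Proof.
move=> fK K0 D le.
set H := [set a | _].
have s1 : \sum_(a in H) f a <= #|H| * K.
  by rewrite -sum_nat_const; apply: leq_sum => a _.
have s2 : 2 * D * (\sum_(a in ~: H) f a) <= #|~: H| * K.
  rewrite -sum_nat_const big_distrr /=; apply: leq_sum => a.
  by rewrite !inE -ltnNge => /ltnW.
rewrite (bigID (mem H)) /= in le.
have e : \sum_(i | i \notin H) f i = \sum_(i in ~: H) f i.
  by apply: eq_bigl => i; rewrite !inE.
rewrite e in le.
have c : #|~: H| <= #|V| by apply: max_card.
rewrite -(leq_pmul2r K0).
have := leq_mul c (leqnn K).
have : 2 * D * (\sum_(a in H) f a) <= 2 * D * (#|H| * K) by rewrite leq_mul2l s1 orbT.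
move: le s2; move: (\sum_(i in ~: H) f i) (\sum_(i in H) f i) #|~: H| #|H| #|V|.
by move=> a b c' d e'; nia.
Qed.

(** Induction on [k], with [H] the set of vertices of dense link. If [B] meets [H] in at most [h]
    vertices, the complement of [H] serves as [C]. Otherwise some [a] in [B :&: H] has fewer than
    [h ^ k] tuples of its link inside [B], and its link is treated with density constant [2 * D]. *)
Lemma dense_cover k : forall D h (Psi : {set k.-tuple V}),
  0 < #|V| -> #|V| ^ k <= D * #|Psi| ->
  covered (#|V|.+1 ^ k)
    (fun B : {set V} => #|[set t in Psi | all (mem B) t]| < h ^ k)
    (fun B C : {set V} => #|B :\: C| <= h /\ #|V| <= 2 ^ k * D * #|~: C|).
Proof.
elim: k => [|k IH] D h Psi V0 dPsi.
  (* For [k = 0] density puts the empty tuple in [Psi], so no [B] qualifies. *)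
  exists [::] => // B; rewrite expn0 ltnS leqn0 cards_eq0 => /eqP e0.
  have : 0 < #|Psi| by move: dPsi; rewrite expn0; case: #|_|; rewrite ?muln0.
  case/card_gt0P => t tP; have : t \in set0.
    by rewrite -e0 inE tP tuple0.
  by rewrite inE.
pose K := #|V| ^ k; have K0 : 0 < K by rewrite expn_gt0 V0.
pose H := [set a | K <= 2 * D * #|link Psi a|].
have cH : #|V| <= 2 * D * #|H|.
  apply: card_large_values => // [a|]; last by rewrite -card_link -expnS.
  by rewrite /K -card_tuple max_card.
have le : 1 + #|V| * #|V|.+1 ^ k <= #|V|.+1 ^ k.+1.
  by rewrite expnS mulSn leq_add2r expn_gt0.
pose P1 (B : {set V}) := #|B :&: H| <= h.
pose Q a (B : {set V}) :=
  (a \in H) && (#|[set t in link Psi a | all (mem B) t]| < h ^ k).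
suff cov : covered (1 + #|V| * #|V|.+1 ^ k)
    (fun B : {set V} => #|[set t in Psi | all (mem B) t]| < h ^ k.+1)
    (fun B C : {set V} => #|B :\: C| <= h /\ #|V| <= 2 ^ k.+1 * D * #|~: C|).
  exact: covered_sub cov.
apply: (covered_or (P1 := P1) (P2 := fun B => exists a, Q a B)).
- apply: (covered1 (y := ~: H)) => // B PB; split; first by rewrite setDE setCK.
  rewrite setCK (leq_trans cH) // leq_mul2r leq_mul2r expnS.
  by rewrite leq_pmulr ?expn_gt0 // !orbT.
- apply: (covered_union (Q := Q)) => // a.
  case: (boolP (a \in H)) => aH; last first.
    by exists [::] => // B; rewrite /Q (negPf aH).
  have := IH (2 * D) h (link Psi a) V0; rewrite inE in aH; move=> /(_ aH).
  apply: covered_sub => // [B /andP[]//|B C _ []].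
  by rewrite expnSr mulnA.
- move=> B PB; apply: contrapT => /not_orP[/negP]; rewrite -ltnNge => hB nQ.
  move: PB; apply/negP; rewrite -leqNgt card_link expnS.
  apply: (@leq_trans (#|B :&: H| * h ^ k)); first by rewrite leq_mul2r ltnW ?orbT.
  rewrite -sum_nat_const [X in _ <= X](bigID (mem (B :&: H))) /=.
  rewrite (leq_trans _ (leq_addr _ _)) //; apply: leq_sum => a; rewrite inE => /andP[aB aH].
  rewrite leqNgt; apply/negP => lt; apply: nQ; exists a; rewrite /Q aH /=.
  apply: leq_ltn_trans lt; apply: subset_leq_card; apply/fintype.subsetP => t.
  by rewrite !inE /= aB.
Qed.

Lemma small_set_list (h : nat) :
  exists2 L : seq {set V}, size L <= #|V|.+1 ^ h &
    forall S : {set V}, #|S| <= h -> S \in L.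
Proof.
exists [seq [set x | Some x \in (t : seq _)] | t : h.-tuple (option V)].
  by rewrite size_map -cardE card_tuple card_option.
move=> S hS.
have sz : size ([seq Some x | x <- enum S] ++ nseq (h - #|S|) None) == h.
  by rewrite size_cat size_map size_nseq -cardE subnKC.
apply/mapP; exists (Tuple sz); first by rewrite mem_enum.
apply/setP => x; rewrite inE mem_cat mem_nseq andbF orbF.
by rewrite mem_map ?mem_enum //; exact: Some_inj.
Qed.

(** The exceptional vertices are listed and added to [C]; since [h] is small, the complement loses
    at most half of its guaranteed size. *)
Lemma dense_cover_exact k D h (Psi : {set k.-tuple V}) :
  0 < #|V| -> #|V| ^ k <= D * #|Psi| -> 2 ^ k.+1 * D * h <= #|V| ->
  covered (#|V|.+1 ^ (k + h))
    (fun B : {set V} => #|[set t in Psi | all (mem B) t]| < h ^ k)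
    (fun B C : {set V} => B \subset C /\ #|V| <= 2 ^ k.+1 * D * #|~: C|).
Proof.
move=> V0 dPsi hV; have [L sL cL] := dense_cover h V0 dPsi.
have [L' sL' cL'] := small_set_list h.
exists [seq C :|: Z | C <- L, Z <- L'].
  by rewrite size_allpairs expnD leq_mul.
move=> B /cL[C CL [hBC VC]]; exists (C :|: (B :\: C)).
  by apply: allpairs_f => //; apply: cL'.
split; first by rewrite setDE setUIr setUCr setIT subsetUr.
have : #|~: C| <= #|~: (C :|: B :\: C)| + h.
  rewrite (leq_trans _ (leq_add (leqnn _) hBC)) //.
  rewrite (leq_trans _ (leq_card_setU _ _)) //; apply: subset_leq_card.
  by apply/fintype.subsetP => x; rewrite !inE; case: (x \in C); case: (x \in B).
move: hV VC; rewrite expnS; move: (2 ^ k) #|~: C| #|V| #|~: (C :|: _)| => a b c d.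
move=> h1 h2 h3; have : a * D * b <= a * D * (d + h) by rewrite leq_mul2l h3 orbT.
nia.
Qed.

End Dense.

(** * Choice of the numerical parameters *)

Lemma leq_bernoulli a t j : a ^ j * (a + j * t) <= a * (a + t) ^ j.
Proof.
elim: j => [|j IH]; first by rewrite mul0n addn0 mul1n muln1.
rewrite [(a + t) ^ _]expnS mulnCA; apply: leq_trans (leq_mul (leqnn (a + t)) IH).
by rewrite expnS; move: (a ^ j) => x; nia.
Qed.

(** By Bernoulli with [a = n - t], the product of [j] factors [(n - t) / n] is at most [1 / 2]. *)
Lemma expn_sub_halves n t j L :
  0 < n -> 0 < j -> n <= j * t -> 2 ^ L * (n - t) ^ (j * L) <= n ^ (j * L).
Proof.
move=> n0 j0 njt; rewrite !expnM -expnMn.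
suff le : 2 * (n - t) ^ j <= n ^ j.
  by case: L => // L; rewrite leq_exp2r.
case: (leqP n t) => nt.
  by rewrite (eqP (_ : n - t == 0)) ?subn_eq0 // exp0n // muln0.
have := leq_bernoulli (n - t) t j; rewrite (subnK (ltnW nt)) => le.
rewrite -(@leq_pmul2l (n - t)) ?subn_gt0 //; apply: leq_trans le.
have : 2 * (n - t) <= n - t + j * t by lia.
move: ((n - t) ^ j) (n - t + j * t) => p b; nia.
Qed.

Lemma exists_root n k : 0 < k -> exists u, u ^ k <= n < u.+1 ^ k.
Proof.
move=> k0; have ex : exists u, u ^ k <= n by exists 0; rewrite exp0n.
have bd u : u ^ k <= n -> u <= n.
  by apply: leq_trans; rewrite -{1}(expn1 u); case: u => // u; rewrite leq_pexp2l.
case: (ex_maxnP ex bd) => u un umax; exists u; rewrite un ltnNge /=.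
by apply/negP => /umax; rewrite ltnn.
Qed.

(* [u] is the integer part of [n ^ (1 / 4s)]; then [h] is about [n / u], [tau]
   is about [n / u ^ s] and [m] about [(n / tau) log n]. *)
Lemma parameters s E : 0 < s -> 0 < E -> exists N, forall n, N <= n ->
  exists u h tau m X,
  [/\ 0 < u, n < u.+1 ^ (4 * s), 0 < h & E * h <= n] /\
  [/\ forall j, j < s -> E * tau * n ^ j <= h ^ j * n,
      forall j, j < s -> n ^ j * (n - tau) ^ m < n ^ m,
      (n ^ m * (2 ^ n) ^ m * (n.+1 ^ (s + h) + 1) ^ n) ^ s <= n ^ X
    & X * u <= s * (6 * s + 2 * (s + 2)) * n ^ 2].
Proof.
move=> s0 E0; exists ((E + 2) ^ (4 * s)) => n nN.
have [|u /andP[un nu]] := @exists_root n (4 * s); first by rewrite muln_gt0.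
have uE : E + 2 <= u.
  rewrite -ltnS -(@ltn_exp2r _ _ (4 * s)) ?muln_gt0 //.
  exact: leq_ltn_trans nN nu.
have u0 : 0 < u by lia.
have upow a b : a <= b -> u ^ a <= u ^ b by move=> ab; rewrite leq_pexp2l.
have u_n : u <= n by apply: leq_trans un; rewrite -{1}(expn1 u) upow // muln_gt0.
have n0 : 0 < n by apply: leq_trans u_n.
have n2 : 2 <= n by apply: leq_trans u_n; lia.
pose h := n %/ u.
have h0 : 0 < h by rewrite divn_gt0.
have hu : h * u <= n by apply: leq_divM.
have h2u : n <= 2 * u * h.
  rewrite (leq_trans (ltnW (ltn_ceil n u0))) // mulnAC leq_mul2r -/h; lia.
(* Since [n / h <= 2 * u], this [K] makes [tau * K <= n] enough for the bounds on
   [E * tau * n ^ j]. *)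
have [K eK] : exists K, K = E * (2 * u) ^ s by exists (E * (2 * u) ^ s).
(* The exponent [4 * s] enters next: [E], [2 ^ s], [u ^ s] and the extra [u] are each at most
   [u ^ s]. *)
have K0 : 0 < K by rewrite eK muln_gt0 E0 expn_gt0 muln_gt0 u0.
have Ku : K * u <= n.
  apply: leq_trans un; rewrite eK expnMn.
  have -> : 4 * s = s + s + (s + s) by lia.
  rewrite !expnD [_ * u]mulnC mulnA [u * E]mulnC -mulnA.
  have le1 : E <= u ^ s.
    by apply: leq_trans (_ : u ^ 1 <= _); [lia | rewrite upow].
  have le2 : u <= u ^ s by rewrite -{1}(expn1 u) upow.
  have le3 : 2 ^ s <= u ^ s by rewrite leq_exp2r //; lia.
  by rewrite -[u ^ s * u ^ s * _]mulnA leq_mul // leq_mul // leq_mul.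
have Kn : K <= n by apply: leq_trans Ku; rewrite leq_pmulr.
pose tau := n %/ K.
have tau0 : 0 < tau by rewrite divn_gt0.
have tauK : tau * K <= n by apply: leq_divM.
have tau2K : n <= 2 * K * tau.
  rewrite (leq_trans (ltnW (ltn_ceil n K0))) // mulnAC leq_mul2r -/tau; lia.
pose l := (trunc_log 2 n).+1.
have nl : n < 2 ^ l by apply: trunc_log_ltn.
have ln2 : 2 ^ l <= n ^ 2.
  by rewrite /l expnS expnS expn1 leq_mul // trunc_logP.
have l_n : l <= n.
  rewrite /l; have := trunc_logP (ltnSn 1) n0; apply: leq_trans.
  exact: ltn_expl.
(* Then [n ^ s < 2 ^ L], and [m] draws gain a factor [2 ^ L] because [n <= 2 * K * tau]. *)
pose L := s * l; pose m := 2 * K * L.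
(* The summands are exponents of [n] for the three factors of the count, by [l <= n],
   [2 ^ l <= n ^ 2] and [n + 1 <= n ^ 2]. *)
exists u, h, tau, m, (s * (2 * K * s * n + 4 * K * s * n + 2 * (s + h + 1) * n)).
split; split => //.
- by apply: leq_trans hu; rewrite mulnC leq_mul2l; apply/orP; right; lia.
- move=> j js; apply: (@leq_trans (E * tau * ((2 * u) ^ j * h ^ j))).
    by rewrite leq_mul2l -expnMn; case: (j) => [|i]; rewrite ?orbT // leq_exp2r ?h2u ?orbT.
  rewrite mulnA [X in _ <= X]mulnC leq_mul2r; apply/orP; right.
  apply: leq_trans tauK; rewrite mulnAC [tau * K]mulnC leq_mul2r eK leq_mul2l.
  by rewrite leq_pexp2l ?orbT ?muln_gt0 // ltnW.
- move=> j js; have le := @expn_sub_halves n tau (2 * K) L n0 _ tau2K.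
  have {le} le : 2 ^ L * (n - tau) ^ m <= n ^ m by apply: le; rewrite muln_gt0.
  have [z|z] := posnP ((n - tau) ^ m); first by rewrite z muln0 expn_gt0 n0.
  apply: leq_trans le; rewrite ltn_pmul2r // /L mulnC expnM.
  apply: (@leq_ltn_trans (n ^ s)); first by rewrite leq_pexp2l // ltnW.
  by rewrite ltn_exp2r.
- rewrite [X in _ <= n ^ X]mulnC [X in _ <= X]expnM leq_exp2r // (expnD n) (expnD n) !leq_mul //.
  + rewrite leq_pexp2l // /m /L; move: l_n; move: (l) => z; nia.
  + rewrite -expnM mulnC /m /L !mulnA.
    rewrite [X in 2 ^ X](_ : _ = l * (2 * K * s * n)); last by nia.
    rewrite expnM (_ : 4 * K * s * n = 2 * (2 * K * s * n)); last by nia.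
    by rewrite [X in _ <= X]expnM; apply: leq_expl.
  + rewrite expnM; apply: leq_expl.
    apply: (@leq_trans (n.+1 ^ (s + h + 1))).
      rewrite addn1 addn1 expnS.
      have : 0 < n.+1 ^ (s + h) by rewrite expn_gt0.
      nia.
    rewrite expnM; apply: leq_expl; rewrite expnS expn1; nia.
- rewrite -!mulnA leq_mul2l; apply/orP; right.
  rewrite [X in X <= _](_ : _ = n * (6 * s * (K * u) + 2 * (s * u + h * u + u))); last by lia.
  rewrite [X in _ <= X](_ : _ = n * (6 * s * n + 2 * (s * n + n + n))); last by lia.
  by rewrite leq_mul2l leq_add ?orbT // ?leq_mul2l ?Ku ?orbT // !leq_add // leq_mul2l u_n orbT.
Qed.

(** * Containers for relations free of dangerous cliques *)

Section Clique.
Variable V : finType.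
Implicit Types (I C : {set V * V}) (a : V).

Definition nbr I a : {set V} := [set y | (a, y) \in I].

(** [pairwise] follows the order of the tuple: on [a :: t] it says that [t] lies in [nbr I a] and is
    itself a clique. *)
Definition clique_free k (Phi : {set k.-tuple V}) I : Prop :=
  forall t, t \in Phi -> ~~ pairwise (fun x y => (x, y) \in I) t.

(* The tuples outside [T] give dense links [link Phi a :\: T], in which all but
   few neighbourhoods are nearly independent. *)
Lemma sparse_cover k D h tau U (Phi : {set k.+1.-tuple V})
    (T : {set k.-tuple V}) :
  0 < #|V| -> 0 < h -> 0 < D ->
  2 ^ k.+3 * D * h <= #|V| -> 8 * D * tau * #|V| ^ k <= h ^ k * #|V| ->
  #|V|.+1 ^ (k + h) + 1 <= U ->
  #|V| ^ k.+1 <= D * #|Phi| -> 2 * D * #|T| < #|V| ^ k ->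
  covered (U ^ #|V|)
    (fun I => forall t, t \notin T ->
       #|[set a | (t \in link Phi a) && all (mem (nbr I a)) t]| <= tau)
    (fun I C => I \subset C /\ #|V| ^ 2 <= 2 ^ k.+1 * 32 * D ^ 2 * #|~: C|).
Proof.
move=> V0 h0 D0 hV htau hU dPhi dT.
pose Psi a := link Phi a :\: T.
pose K := #|V| ^ k; have K0 : 0 < K by rewrite expn_gt0 V0.
pose few a (B : {set V}) := #|[set t in Psi a | all (mem B) t]| < h ^ k.
(* Containment is required at every vertex, the gain only where the link is dense and the
   neighbourhood spans few tuples; elsewhere [setT] serves. *)
pose R a (B C : {set V}) := B \subset C /\
  (K <= 2 * (2 * D) * #|Psi a| -> few a B -> #|V| <= 2 ^ k.+3 * D * #|~: C|).
have cR a : covered U (fun=> True) (R a).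
  case: (boolP (K <= 2 * (2 * D) * #|Psi a|)) => ha; last first.
    apply: (covered1 (y := setT)); first by rewrite (leq_trans _ hU) ?leq_addl.
    by move=> B _; split; rewrite ?(negPf ha).
  apply: (covered_sub hU (P := fun=> True) (R := R a)) => //.
  apply: (covered_or (P1 := fun B => few a B) (P2 := fun B => ~~ few a B)).
  - apply: covered_sub (dense_cover_exact (h := h) V0 ha _) => //.
      move=> B C fB [BC VC]; split => // _ _; apply: leq_trans VC _.
      rewrite leq_mul2r; apply/orP; right; rewrite !expnS; lia.
    apply: leq_trans hV; rewrite leq_mul2r; apply/orP; right.
    by rewrite !expnS; lia.
  - apply: (covered1 (y := setT)) => // B nB; split; first exact: subsetT.
    by rewrite (negPf nB).
  - by move=> B _; case: (few a B); [left|right].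
have := covered_prod setT cR.
apply: (covered_map (f := fun I a => nbr I a)
  (g := fun y : {ffun V -> {set V}} => [set p : V * V | p.2 \in y p.1])) => //.
move=> I C degI RC; split.
  apply/fintype.subsetP => -[x y] xyI; rewrite inE /=.
  by have [/fintype.subsetP s _] := RC x; apply: s; rewrite inE.
set Cs := [set p | _].
have cC : #|~: Cs| = \sum_a #|~: C a|.
  rewrite -sum1_card (eq_bigl (fun p : V * V => p.2 \notin C p.1)); last first.
    by move=> p; rewrite !inE.
  rewrite -(pair_big_dep xpredT (fun a y => y \notin C a) (fun _ _ => 1)) /=.
  by apply: eq_bigr => a _; rewrite -sum1_card; apply: eq_bigl => y; rewrite inE.
pose H := [set a | K <= 2 * (2 * D) * #|Psi a|].
have cH : #|V| <= 2 * (2 * D) * #|H|.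
  apply: card_large_values => // [a|].
    by rewrite /K -card_tuple max_card.
  (* Discarding [T] costs at most [#|V| * #|T|] tuples, less than half of the guaranteed
     [#|V| ^ k.+1 / D]; hence the constant [2 * D]. *)
  have le : #|Phi| <= \sum_a #|Psi a| + #|V| * #|T|.
    rewrite card_link -sum_nat_const -big_split /=; apply: leq_sum => a _.
    rewrite -(cardsID T (link Phi a)) addnC leq_add2l.
    by rewrite subset_leq_card // subsetIr.
  move: dPhi; rewrite expnS -/K => dPhi.
  have : D * #|Phi| <= D * (\sum_a #|Psi a| + #|V| * #|T|) by rewrite leq_mul2l le orbT.
  have : #|V| * (2 * D * #|T|) <= #|V| * K by rewrite leq_mul2l (ltnW dT) orbT.
  move: dPhi; move: (\sum_a _) #|Phi| => x y; nia.
pose B := [set a | ~~ few a (nbr I a)].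
(* Double counting of pairs [(a, t)]: each [t] outside [T] occurs with at most [tau] vertices, each
   [a] in [B] with at least [h ^ k] tuples. *)
have cB : 8 * D * #|B| <= #|V|.
  have s1 : #|B| * h ^ k <= \sum_a #|[set t in Psi a | all (mem (nbr I a)) t]|.
    rewrite -sum_nat_const [X in _ <= X](bigID (mem B)) /=.
    rewrite (leq_trans _ (leq_addr _ _)) //; apply: leq_sum => a.
    by rewrite inE /few -leqNgt.
  have s2 : \sum_a #|[set t in Psi a | all (mem (nbr I a)) t]| <= tau * K.
    rewrite (eq_bigr (fun a => \sum_(t : k.-tuple V)
      ((t \notin T) && (t \in link Phi a) && all (mem (nbr I a)) t : nat))); last first.
      move=> a _; rewrite -sum1_card big_mkcond; apply: eq_bigr => t _.
      by rewrite inE in_setD; case: ifP.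
    rewrite exchange_big /= mulnC /K -card_tuple -sum_nat_const.
    apply: leq_sum => t _; case: (boolP (t \in T)) => tT /=.
      by rewrite big1.
    apply: leq_trans (degI _ tT).
    rewrite -sum1_card [X in _ <= X]big_mkcond; apply: leq_sum => a _.
    by rewrite inE; case: (_ && _).
  have hk : 0 < h ^ k by rewrite expn_gt0 h0.
  rewrite -(leq_pmul2r hk) [X in _ <= X]mulnC; apply: leq_trans htau.
  by rewrite -!mulnA !leq_mul2l (leq_trans s1 s2) !orbT.
have cHB : #|V| <= 8 * D * #|H :\: B|.
  have : #|H| <= #|B| + #|H :\: B|.
    by rewrite -(cardsID B H) leq_add2r subset_leq_card // subsetIr.
  move: cH cB => h1 h2 h3.
  have : 8 * D * #|H| <= 8 * D * (#|B| + #|H :\: B|) by rewrite leq_mul2l h3 orbT.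
  move: h1 h2; move: #|H| #|B| #|H :\: B| #|V|; nia.
have big : #|H :\: B| * #|V| <= 2 ^ k.+3 * D * #|~: Cs|.
  rewrite cC big_distrr /= -sum_nat_const [X in _ <= X](bigID (mem (H :\: B))) /=.
  rewrite (leq_trans _ (leq_addr _ _)) //; apply: leq_sum => a.
  rewrite !inE negbK => /andP[fa ha]; have [_] := RC a; exact.
have := leq_mul (leqnn (8 * D)) big.
have := leq_mul cHB (leqnn #|V|).
rewrite !expnS expn0 !muln1; move: (2 ^ k) #|~: Cs| #|V| #|H :\: B|; nia.
Qed.

End Clique.

(* The number of sets is a product of three factors per step: [m] vertices of
   a hitting set, their neighbourhoods, and one approximating set for the
   neighbourhood of each vertex. *)
Lemma clique_cover k : forall D, 0 < D -> exists2 E, 0 < E &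
  forall (V : finType) (h tau m U : nat), 0 < #|V| -> 0 < h ->
    E * h <= #|V| ->
    (forall j, j < k -> E * tau * #|V| ^ j <= h ^ j * #|V|) ->
    (forall j, j < k -> #|V| ^ j * (#|V| - tau) ^ m < #|V| ^ m) ->
    #|V|.+1 ^ (k + h) + 1 <= U ->
  forall Phi : {set k.-tuple V}, #|V| ^ k <= D * #|Phi| ->
  covered ((#|V| ^ m * (2 ^ #|V|) ^ m * U ^ #|V|) ^ k) (clique_free Phi)
    (fun I C : {set V * V} => I \subset C /\ #|V| ^ 2 <= E * #|~: C|).
Proof.
elim: k => [|k IH] D D0.
  exists 1 => // V h tau m U V0 _ _ _ _ _ Phi; rewrite expn0 => dPhi.
  exists [::] => // I cfI.
  have : 0 < #|Phi| by move: dPhi; case: #|_|; rewrite ?muln0.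
  by case/card_gt0P => t /cfI; rewrite tuple0.
have [|E E0 HE] := IH (2 * D); first by rewrite muln_gt0.
pose E1 := 2 ^ k.+1 * 32 * D ^ 2.
exists (E + E1); first by rewrite addn_gt0 E0.
move=> V h tau m U V0 h0 hV htau hm hU Phi dPhi.
have U0 : 0 < U by apply: leq_trans hU; rewrite addn1.
have hU' : #|V|.+1 ^ (k + h) + 1 <= U.
  by apply: leq_trans hU; rewrite leq_add2r leq_pexp2l // addSn.
pose W := #|V| ^ m * (2 ^ #|V|) ^ m * U ^ #|V|.
have W0 : 0 < W by rewrite !muln_gt0 !expn_gt0 V0 U0.
(* A certificate consists of the hitting vertices and their neighbourhoods; [T c] is the set of
   dangerous tuples they reveal. *)
pose T (c : {ffun 'I_m -> V} * {ffun 'I_m -> {set V}}) : {set k.-tuple V} :=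
  [set t | [exists i, (t \in link Phi (c.1 i)) && all (mem (c.2 i)) t]].
pose nb I t := [set a | (t \in link Phi a) && all (mem (nbr I a)) (t : k.-tuple V)].
pose Q (c : {ffun 'I_m -> V} * {ffun 'I_m -> {set V}}) I :=
  clique_free (T c) I /\ forall t, t \notin T c -> #|nb I t| <= tau.
(* One bound serves both branches: recursion needs [W ^ k], the sparse case [U ^ #|V|]. *)
suff cov : covered (#|{: {ffun 'I_m -> V} * {ffun 'I_m -> {set V}}}| * (W ^ k * U ^ #|V|))
    (clique_free Phi) (fun I C : {set V * V} => I \subset C /\ #|V| ^ 2 <= (E + E1) * #|~: C|).
  apply: covered_sub cov => //.
  have cS : #|{: {set V}}| = 2 ^ #|V|.
    rewrite -cardsT -card_powerset; apply: eq_card => Z.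
    by rewrite !inE subsetT.
  rewrite card_prod !card_ffun card_ord cS.
  by rewrite expnS mulnCA [X in X <= _]mulnC leqnn.
apply: (covered_union (Q := Q)) => [c|I cfI].
  case: (leqP (#|V| ^ k) (2 * D * #|T c|)) => dT.
    apply: covered_sub (HE V h tau m U V0 h0 _ _ _ hU' _ dT).
    - by rewrite leq_pmulr // expn_gt0 U0.
    - by move=> I [].
    - move=> I C _ [IC VC]; split => //; apply: leq_trans VC _.
      by rewrite leq_mul2r leq_addr orbT.
    - by apply: leq_trans hV; rewrite leq_mul2r leq_addr orbT.
    - move=> j jk; apply: leq_trans (htau j (ltnW jk)).
      by rewrite -!mulnA leq_mul2r leq_addr orbT.
    - by move=> j jk; apply: hm; apply: ltnW.
  apply: covered_sub (sparse_cover (tau := tau) V0 h0 D0 _ _ hU' dPhi dT).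
  - by rewrite leq_pmull // expn_gt0 W0.
  - by move=> I [].
  - move=> I C _ [IC VC]; split => //; apply: leq_trans VC _.
    by rewrite leq_mul2r leq_addl orbT.
  - apply: leq_trans hV; rewrite leq_mul2r; apply/orP; right.
    by rewrite /E1 !expnS; move: (2 ^ k); nia.
  - apply: leq_trans (htau k _) => //.
    rewrite leq_mul // leq_mul //.
    rewrite /E1 !expnS; have : 0 < 2 ^ k by rewrite expn_gt0.
    by move: (2 ^ k); nia.
(* With threshold [tau.+1], every set missed by [A] has at most [tau] elements. *)
have [|A HA] := @hitting_set V _ (nb I) tau.+1 m.
  rewrite card_tuple; apply: leq_ltn_trans (hm k _) => //.
  by rewrite leq_mul2l leq_expl ?orbT // leq_sub2l.
exists (A, [ffun i => nbr I (A i)]); split.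
  (* A clique [t] in [T c] would extend by a vertex of [A] to a clique in [Phi]. *)
  move=> t; rewrite inE => /existsP[i /=]; rewrite ffunE inE => /andP[/cfI /=].
  rewrite negb_and => /orP[/negP n1|//] al; case: n1; apply: sub_all al => y.
  by rewrite /= inE.
move=> t; rewrite inE leqNgt => nT; apply/negP => /HA[i]; rewrite inE => Hi.
by move/negP: nT; apply; apply/existsP; exists i; rewrite /= ffunE.
Qed.

(** * Lowering a multigraph away from the tight pairs *)

Lemma upair_map_bij (V W : finType) (f : V -> W) (f_bij : bijective f) :
  bijective (upair_map (bij_inj f_bij)).
Proof.
have [g fK gK] := f_bij; exists (upair_map (can_inj gK)) => e; apply: val_inj => /=.
  by rewrite -imset_comp (eq_imset _ fK) imset_id.
by rewrite -imset_comp (eq_imset _ gK) imset_id.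
Qed.

Lemma isomorphic_weight (V W : finType) (G : multigraph V) (H : multigraph W) :
  isomorphic G H -> weight G = weight H.
Proof.
case=> f [f_bij eGH]; rewrite /weight.
have [g fK gK] := upair_map_bij f_bij.
rewrite [RHS](reindex (upair_map (bij_inj f_bij))); last by exists g => ? _.
by apply: eq_bigr => e _; rewrite eGH.
Qed.

Section Multigraph.
Variable V : finType.
Implicit Types (G J : multigraph V) (C : {set V * V}).

Definition heavy_tuples s q G : {set s.-tuple V} :=
  [set t : s.-tuple V | uniq t && (q < weight (induced G [set x | x \in t]))].

(** Enumerating a bad set gives a heavy tuple with that range, since isomorphism preserves
    weight. *)
Lemma card_bad_copies s q G : #|bad_copies G s q| <= #|heavy_tuples s q G|.
Proof.
apply: leq_trans (leq_imset_card (fun t : s.-tuple V => [set x | x \in t]) _).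
apply: subset_leq_card; apply/fintype.subsetP => X.
rewrite inE => /andP[/eqP cX /asboolP[H]]; rewrite inE => /andP[_ qH] iso.
have sz : size (enum X) == s by rewrite -cardE cX.
have eX : [set x | x \in Tuple sz] = X by apply/setP => x; rewrite inE mem_enum.
apply/imsetP; exists (Tuple sz); last by rewrite eX.
by rewrite inE enum_uniq eX (isomorphic_weight iso).
Qed.

(** No [upair] has the form [{x, x}], so diagonal pairs are vacuously tight and anything outside a
    container has two distinct entries. *)
Definition tight J G : {set V * V} :=
  [set p | [forall e : upair V, (val e == [set p.1; p.2]) ==> (J e == G e)]].

(** On a tight clique [t], [J] and [G] agree, so [J] would have weight above [q] on [s] vertices. *)
Lemma tight_clique_free s q J G :
  sq_graph s q J -> clique_free (heavy_tuples s q G) (tight J G).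
Proof.
move=> sqJ t; rewrite inE => /andP[ut qG]; apply/negP => pw.
move/forallP/(_ [set x | x \in t]): sqJ.
have -> : #|[set x | x \in t]| == s.
  by rewrite cardsE (card_uniqP ut) size_tuple.
apply/negP; rewrite implyTb -ltnNge.
suff -> : induced J [set x | x \in t] = induced G [set x | x \in t] by [].
apply/ffunP => e; rewrite !ffunE.
have tightV x y : x \in t -> y \in t -> x != y ->
    [forall e : upair V, (val e == [set x; y]) ==> (J e == G e)].
  move=> xt yt xy; move: pw; have := xy.
  rewrite -(nth_index x xt) -(nth_index x yt) nth_uniq ?index_mem // neq_ltn.
  move=> /orP[lt|lt] /(pairwiseP x)/(_ _ _ _ _ lt); rewrite !inE !index_mem.
    by move=> /(_ xt yt).
  move=> /(_ yt xt) /= /forallP H; apply/forallP => e'.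
  by rewrite setUC.
have /cards2P[x [y [xy exy]]] := valP e.
have xt : val x \in t by have := valP x; rewrite inE.
have yt : val y \in t by have := valP y; rewrite inE.
have /forallP/(_ (upair_map val_inj e))/implyP H := tightV _ _ xt yt xy.
apply/eqP/H => /=.
by rewrite exy imsetU1 imset_set1.
Qed.

Definition missed C (e : upair V) : bool :=
  [exists p, (p \notin C) && (val e == [set p.1; p.2])].

Definition lower G C : multigraph V := [ffun e => G e - missed C e].

(** Both orientations of a pair where [J] and [G] agree lie in [C]. Strictness keeps [J] below after
    subtracting 1 and shows that this subtraction is not truncated. *)
Lemma missed_lt J G C e : submultigraph J G -> tight J G \subset C ->
  missed C e -> J e < G e.
Proof.
move=> /forallP JG /fintype.subsetP TC /existsP[p /andP[pC /eqP ep]].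
rewrite ltn_neqAle JG andbT; apply: contraNneq pC => eJG; apply: TC.
rewrite inE; apply/forallP => e'; apply/implyP => /eqP ep'.
by rewrite (_ : e' = e) ?eJG //; apply: val_inj; rewrite ep ep'.
Qed.

Lemma sub_lower J G C : submultigraph J G -> tight J G \subset C ->
  submultigraph J (lower G C).
Proof.
move=> JG TC; apply/forallP => e; rewrite ffunE.
case: (boolP (missed C e)) => [/(missed_lt JG TC)|_]; first by lia.
by rewrite subn0; move/forallP: JG.
Qed.

(** The factor 4 is [#|e| ^ 2]: each pair outside [C] lies in the square of a missed [e]. *)
Lemma weight_lower J G C : submultigraph J G -> tight J G \subset C ->
  #|~: C| + 4 * weight (lower G C) <= 4 * weight G.
Proof.
move=> JG TC.
have -> : weight G = weight (lower G C) + #|[set e | missed C e]|.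
  rewrite /weight -sum1_card [X in _ = _ + X]big_mkcond -big_split /=; apply: eq_bigr => e _.
  rewrite ffunE inE; case: (boolP (missed C e)) => [/(missed_lt JG TC)|_]; lia.
rewrite mulnDr addnC leq_add2l.
have sub : ~: C \subset \bigcup_(e in [set e | missed C e]) setX (val e) (val e).
  apply/fintype.subsetP => -[x y]; rewrite inE => xyC.
  have xy : #|[set x; y]| == 2.
    rewrite cards2; case: (x =P y) => // exy; case/negP: xyC.
    apply: (fintype.subsetP TC); rewrite inE; apply/forallP => e; apply/implyP => /eqP ee.
    by have := valP e; rewrite ee /= exy setUid cards1.
  apply/bigcupP; exists (Sub [set x; y] xy); last by rewrite !inE !eqxx orbT.
  by rewrite inE; apply/existsP; exists (x, y); rewrite xyC SubK eqxx.
apply: leq_trans (subset_leq_card sub) _; apply: leq_trans (card_bigcup_leq _ _) _.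
rewrite mulnC -sum_nat_const; apply: leq_sum => e _.
by rewrite cardsX (eqP (valP e)).
Qed.

Lemma multiplicity_lower G C : multiplicity (lower G C) <= multiplicity G.
Proof.
apply/bigmax_leqP => e _; rewrite ffunE; apply: leq_trans (leq_subr _ _) _.
exact: leq_bigmax.
Qed.

(** Any pair extends to a set of [s] vertices, whose weight bounds it. Hence the constant multigraph
    [q] lies above every (s,q)-graph. *)
Lemma sq_graph_leq s q J e : 2 <= s <= #|V| -> sq_graph s q J -> J e <= q.
Proof.
move=> /andP[s2 sV] /forallP sqJ.
have /cards2P[x [y [xy exy]]] := valP e.
have [X eX cX] : exists2 X : {set V}, val e \subset X & #|X| = s.
  have [B BV cB] : exists2 B : {set V}, B \subset ~: val e & #|B| = s - 2.
    have : s - 2 <= #|~: val e| by rewrite cardsCs setCK (eqP (valP e)) leq_sub2r.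
    move=> le; exists [set z in take (s - 2) (enum (~: val e))].
      by apply/fintype.subsetP => z; rewrite inE => /mem_take; rewrite mem_enum.
    by rewrite cardsE (card_uniqP _) ?take_uniq ?enum_uniq // size_takel -?cardE.
  exists (val e :|: B); first exact: subsetUl.
  rewrite cardsU (eqP (valP e)) cB (_ : val e :&: B = set0) ?cards0; first by lia.
  by apply/setP => z; rewrite !inE; apply/negP => /andP[ze /(fintype.subsetP BV)]; rewrite inE ze.
have := sqJ X; rewrite cX eqxx implyTb; apply: leq_trans.
have xX : x \in X by apply: (fintype.subsetP eX); rewrite exy !inE eqxx.
have yX : y \in X by apply: (fintype.subsetP eX); rewrite exy !inE eqxx orbT.
pose x' : {x | x \in X} := Sub x xX; pose y' : {x | x \in X} := Sub y yX.
have xy' : #|[set x'; y']| == 2 by rewrite cards2 -val_eqE /= xy.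
pose e' : upair {x | x \in X} := Sub [set x'; y'] xy'.
have -> : J e = induced J X e'.
  rewrite ffunE; congr (J _); apply: val_inj => /=.
  by rewrite exy imsetU1 imset_set1.
by rewrite /weight (bigD1 e') //= leq_addr.
Qed.

End Multigraph.

(** * Iteration of the lowering step *)

Lemma covered_bind (X : Type) (Y Z : eqType) (M N : nat)
    (P : X -> Prop) (R : X -> Y -> Prop) (R' : X -> Z -> Prop) :
  covered M P R -> (forall y, covered N (fun x => P x /\ R x y) R') ->
  covered (M * N) P R'.
Proof.
move=> [L sL cL] cN.
apply: (@covered_sub _ _ (#|'I_(size L)| * N) _ P _ R') => //.
  by rewrite card_ord leq_mul2r sL orbT.
case: L sL cL => [|y0 L] sL cL.
  by exists [::] => // x /cL[].
apply: (covered_union (Q := fun (i : 'I_(size (y0 :: L))) x =>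
  P x /\ R x (nth y0 (y0 :: L) i))) => //.
move=> x Px; have [y yL Rxy] := cL x Px.
have iL : index y (y0 :: L) < size (y0 :: L) by rewrite index_mem.
by exists (Ordinal iL); rewrite nth_index.
Qed.

(** One round: the lost weight is at least [#|~: C| / 4], and [#|~: C|] is at least
    [#|V| ^ 2 / E]. *)
Lemma lower_cover s q D : 0 < D -> exists2 E, 0 < E &
  forall (V : finType) (h tau m : nat), 0 < #|V| -> 0 < h ->
    E * h <= #|V| ->
    (forall j, j < s -> E * tau * #|V| ^ j <= h ^ j * #|V|) ->
    (forall j, j < s -> #|V| ^ j * (#|V| - tau) ^ m < #|V| ^ m) ->
  forall G : multigraph V, #|V| ^ s <= D * #|bad_copies G s q| ->
  covered ((#|V| ^ m * (2 ^ #|V|) ^ m * (#|V|.+1 ^ (s + h) + 1) ^ #|V|) ^ s)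
    (fun J => sq_graph s q J /\ submultigraph J G)
    (fun J G' : multigraph V =>
       [/\ submultigraph J G', multiplicity G' <= multiplicity G
         & #|V| ^ 2 + 4 * E * weight G' <= 4 * E * weight G]).
Proof.
move=> D0; have [E E0 HE] := clique_cover s D0; exists E => // V h tau m V0 h0 hV htau hm G dG.
have dPhi : #|V| ^ s <= D * #|heavy_tuples s q G|.
  by apply: leq_trans dG _; rewrite leq_mul2l card_bad_copies orbT.
apply: (covered_map (f := fun J => tight J G) (g := fun C => lower G C)
          (leqnn _) _ _ (HE V h tau m _ V0 h0 hV htau hm (leqnn _) _ dPhi)).
  by move=> J [sqJ _]; apply: tight_clique_free.
move=> J C [sqJ JG] [TC VC]; split; first exact: sub_lower.
  exact: multiplicity_lower.
apply: leq_trans (leq_add VC (leqnn _)) _.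
by rewrite [4 * E]mulnC -!mulnA -mulnDr leq_mul2l (weight_lower JG TC) orbT.
Qed.

(** Each round takes at least [#|V| ^ 2 / K] off the weight, so the budget [r] bounds the number of
    rounds; a good multigraph is kept as its own container. *)
Lemma iterated_cover (V : finType) s q W K (good : pred (multigraph V)) :
  0 < #|V| -> 0 < W ->
  (forall G, ~~ good G ->
    covered W (fun J => sq_graph s q J /\ submultigraph J G)
    (fun J G' : multigraph V =>
       [/\ submultigraph J G', multiplicity G' <= multiplicity G
         & #|V| ^ 2 + K * weight G' <= K * weight G])) ->
  forall r G, K * weight G <= r * #|V| ^ 2 -> multiplicity G <= q ->
  covered (W ^ r) (fun J => sq_graph s q J /\ submultigraph J G)
    (fun J G' : multigraph V =>
       [/\ submultigraph J G', multiplicity G' <= q & good G']).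
Proof.
move=> V0 W0 step; elim=> [|r IH] G wG mG.
  case: (boolP (good G)) => gG.
    by apply: (covered1 (y := G)) => // J [].
  (* With budget 0 the required loss is impossible, so there is no [J] to cover. *)
  have [L _ cL] := step _ gG; exists [::] => // J /cL[G' _ [_ _]].
  by rewrite (leqNgt (_ + _)) (leq_ltn_trans wG) // ltn_addr // expn_gt0 V0.
case: (boolP (good G)) => gG.
  by apply: (covered1 (y := G)) => [|J []//]; rewrite expn_gt0 W0.
rewrite expnS; apply: covered_bind (step _ gG) _ => G'.
case: (boolP ((multiplicity G' <= q) && (K * weight G' <= r * #|V| ^ 2))) => [/andP[mG' wG']|nG'].
  by apply: covered_sub (IH G' wG' mG') => // J [[? _] []].
(* A candidate [G'] violating these bounds is related to no [J]. *)
exists [::] => // J [_ [_ mG' wG']]; case/negP: nG'.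
rewrite (leq_trans mG') //= -(leq_add2l (#|V| ^ 2)); exact: leq_trans wG' wG.
Qed.

(** * Final estimates and conclusion *)

Lemma leq_expn_bin n s : 2 * s <= n -> n ^ s <= 2 ^ s * s`! * 'C(n, s).
Proof.
move=> sn; rewrite -mulnA [s`! * _]mulnC bin_ffact.
suff : forall k, k <= s -> n ^ k <= 2 ^ k * n ^_ k by apply.
elim=> // k IH ks; rewrite expnSr expnSr ffactnSr.
by rewrite mulnACA leq_mul ?IH ?(ltnW ks) //; lia.
Qed.

Lemma weight_const (V : finType) q :
  weight ([ffun=> q] : multigraph V) <= q * #|V| ^ 2.
Proof.
rewrite /weight (eq_bigr (fun=> q)); last by move=> e _; rewrite ffunE.
rewrite sum_nat_const mulnC leq_mul2l; apply/orP; right.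
have -> : #|{: upair V}| = 'C(#|V|, 2).
  rewrite -card_draws card_sig cardsE; exact: eq_card.
rewrite bin2; move: #|V| => n; rewrite expnS expn1.
by rewrite -divn2 (leq_trans (leq_div _ _)) ?leq_mul2l ?leq_pred ?orbT.
Qed.

Import Order.TTheory GRing.Theory Num.Theory.
Local Open Scope ring_scope.

(** This combines [X <= c * n ^ 2 / u] with [n ^ (1 / k) <= u + 1 <= 2 * u]. *)
Lemma powR_root (R : realType) (n u k X c : nat) :
  (0 < n)%N -> (0 < u)%N -> (0 < k)%N -> (n < u.+1 ^ k)%N ->
  (X * u <= c * n ^ 2)%N ->
  X%:R <= 2 * c%:R * n%:R `^ (2 - k%:R^-1) :> R.
Proof.
move=> n0 u0 k0 nu Xu.
set rho : R := n%:R `^ k%:R^-1.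
have nR : 0 < n%:R :> R by rewrite ltr0n.
have rho0 : 0 < rho by rewrite powR_gt0.
have rho_u : rho <= u.+1%:R.
  have -> : u.+1%:R = (u.+1 ^ k)%:R `^ k%:R^-1 :> R.
    rewrite natrX -powR_mulrn // -powRrM divff ?powRr1 // pnatr_eq0; lia.
  by rewrite ge0_ler_powR ?invr_ge0 ?nnegrE ?ler_nat // ltnW.
have -> : n%:R `^ (2 - k%:R^-1) = n%:R ^+ 2 / rho :> R.
  by rewrite powRD ?(gt_eqF nR) ?implybT // powRN powR_mulrn // ler0n.
rewrite mulrA ler_pdivlMr //.
apply: le_trans (_ : X%:R * u.+1%:R <= _); first by rewrite ler_wpM2l.
by rewrite -natrX -!natrM ler_nat; nia.
Qed.

Theorem theorem3p5 (R : realType) (delta : R) (s q : nat)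
  (delta_gt0 : 0 < delta) (delta_lt1 : delta < 1) (s_ge2 : (2 <= s)%N) :
  exists c : R, 0 < c /\
    exists N : nat, forall n : nat, (N <= n)%N ->
      exists GG : {fset multigraph 'I_n},
        [/\ forall G, G \in GG -> (multiplicity G <= q)%N,
            forall J, J \in F n s q ->
              exists G, G \in GG /\ submultigraph J G,
            forall G, G \in GG ->
              (#|bad_copies G s q|)%:R <= delta * ('C(n, s))%:R
          & ln (#|` GG |%fset)%:R
              <= c * n%:R `^ (2 - (4 * s%:R)^-1) * ln n%:R].
Proof.
have s0 : (0 < s)%N by lia.
pose d := Num.bound delta^-1.
have dP : 1 <= d%:R * delta.
  rewrite -ler_pdivrMr // mul1r ltW //.
  by apply: archi_boundP; rewrite invr_ge0 ltW.
have d0 : (0 < d)%N.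
  by rewrite lt0n; apply: contraTneq dP => ->; rewrite mul0r ler10.
(* More than [delta * 'C(n, s)] bad sets then amount to at least [n ^ s / D]. *)
pose D := (d * (2 ^ s * s`!))%N.
have D0 : (0 < D)%N by rewrite !muln_gt0 d0 expn_gt0 fact_gt0.
have [E E0 HE] := lower_cover s q D0.
have [N HN] := parameters s0 E0.
(* [r] is the number of rounds: the starting weight is at most [q * n ^ 2], and a round removes at
   least [n ^ 2 / 4E]. *)
pose c1 := (s * (6 * s + 2 * (s + 2)))%N; pose r := (4 * E * q)%N.
(* The summand 1 keeps the constant positive when [q = 0]. *)
exists (2 * c1%:R * r%:R + 1); split; first by rewrite ltr_wpDl ?mulr_ge0.
exists (N + 2 * s)%N => n Nn.
have [u [h [tau [m [X [[u0 nu h0 hn] [htau hm hX Xu]]]]]]] := HN n (leq_trans (leq_addr _ _) Nn).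
have n2s : (2 * s <= n)%N by apply: leq_trans Nn; exact: leq_addl.
have n0 : (0 < n)%N by lia.
have V0 : (0 < #|'I_n|)%N by rewrite card_ord.
pose good (G : multigraph 'I_n) := (#|bad_copies G s q|)%:R <= delta * ('C(n, s))%:R.
have step (G : multigraph 'I_n) : ~~ good G ->
    covered (n ^ X) (fun J => sq_graph s q J /\ submultigraph J G)
    (fun J G' : multigraph 'I_n =>
       [/\ submultigraph J G', (multiplicity G' <= multiplicity G)%N
         & (#|'I_n| ^ 2 + 4 * E * weight G' <= 4 * E * weight G)%N]).
  move=> bG; have := HE 'I_n h tau m V0 h0; rewrite !card_ord => HE'.
  apply: covered_sub (HE' hn htau hm G _) => //.
  rewrite /good -ltNge in bG.
  apply: leq_trans (leq_expn_bin n2s) _.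
  rewrite /D [(d * _)%N]mulnC -[X in (_ <= X)%N]mulnA leq_mul2l.
  apply/orP; right; rewrite -(ler_nat R) natrM.
  apply: le_trans (_ : d%:R * (delta * ('C(n, s))%:R) <= _).
    by rewrite mulrA ler_peMl.
  by rewrite ler_wpM2l // ltW.
have W0 : (0 < n ^ X)%N by rewrite expn_gt0 n0.
have mq : (multiplicity ([ffun=> q] : multigraph 'I_n) <= q)%N.
  by apply/bigmax_leqP => e _; rewrite ffunE.
have wq : (4 * E * weight ([ffun=> q] : multigraph 'I_n) <= r * #|'I_n| ^ 2)%N.
  by rewrite /r -[(_ * q * _)%N]mulnA leq_mul2l weight_const orbT.
have [L sL cL] := iterated_cover V0 W0 step wq mq.
(* [L] may contain entries serving no [J]; filtering enforces the multiplicity bound and the bound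
   on bad copies. *)
exists [fset G in L | (multiplicity G <= q)%N && good G]%fset; split.
- by move=> G; rewrite !inE => /andP[_ /andP[]].
- move=> J JF; have [|G GL [JG mG gG]] := cL J.
    split => //; apply/forallP => e; rewrite ffunE.
    by apply: (sq_graph_leq _ _ JF); rewrite card_ord s_ge2; lia.
  by exists G; rewrite !inE GL mG.
- by move=> G; rewrite !inE => /andP[_ /andP[]].
set GG := [fset G in L | _]%fset.
have cGG : (#|` GG| <= n ^ (X * r))%N.
  rewrite expnM (leq_trans _ sL) //.
  apply: leq_trans (_ : #|` [fset G in L]%fset| <= _)%N; last first.
    by rewrite card_fseq size_undup.
  by apply: fsubset_leq_card; apply/fsubsetP => G; rewrite !inE => /andP[].
have lnn : 0 <= ln n%:R :> R by rewrite ln_ge0 // ler1n.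
(* For an empty family [ln 0] is 0 by convention. *)
have [z|pos] := posnP #|` GG|.
  by rewrite z ln0 // !mulr_ge0 ?powR_ge0 // addr_ge0 ?mulr_ge0.
apply: le_trans (_ : ln (n ^ (X * r))%:R <= _).
  by rewrite ler_ln ?posrE ?ltr0n ?ler_nat // expn_gt0 n0.
rewrite natrX lnXn ?ltr0n // -[X in X <= _]mulr_natl ler_wpM2r // natrM.
have le : X%:R <= 2 * c1%:R * n%:R `^ (2 - (4 * s%:R)^-1) :> R.
  by rewrite -(natrM R 4 s); apply: powR_root n0 u0 _ nu Xu; rewrite muln_gt0.
apply: le_trans (_ : 2 * c1%:R * n%:R `^ (2 - (4 * s%:R)^-1) * r%:R <= _).
  by rewrite ler_wpM2r.
by rewrite mulrAC ler_wpM2r ?powR_ge0 // lerDl ler01.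
Qed.
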